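(* Let $H>0$ and let $v\in C^1([0,H]\times X)$ be $(\varepsilon,\varepsilon_T)$-feasible for the nominal problem with dynamics $f(t,x,u)$ and costs $(\ell(t,x,u),g(x))$ on the horizon $[0,H]$. For a shift $\tau$, define $v^\tau(t,x):=v(t-\tau,x)$, $f^\tau(t,x,u):=f(t-\tau,x,u)$, $\ell^\tau(t,x,u):=\ell(t-\tau,x,u)$ for $t\in[\tau,\tau+H]$. Consider a perturbed problem on the shifted horizon $[\tau,\tau+H]$ with dynamics and costs $(\tilde f,\tilde\ell,\tilde g)$ satisfying $$\|\tilde f-f^\tau\|_\infty\le\delta_f,\quad\|\tilde\ell-\ell^\tau\|_\infty\le\delta_\ell,\quad\|\tilde g-g\|_\infty\le\delta_g.$$ Then $v^\tau$ is $(\tilde\varepsilon,\tilde\varepsilon_T)$-feasible for the perturbed problem, where $$\tilde\varepsilon=\varepsilon+\delta_\ell+\|\nabla_xv\|_\infty\,\delta_f,\qquad\tilde\varepsilon_T=\varepsilon_T+\delta_g.$$ It yields the certified lower bound $$\langle v^\tau(\tau,\cdot),\mu_\tau\rangle-H\mu_\tau(X)\tilde\varepsilon-\mu_\tau(X)\tilde\varepsilon_T\le\tilde P,$$ where $\mu_\tau$ is the state distribution at time $\tau$ and $\tilde P$ is the optimal value of the perturbed problem.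
   Context: $X\subseteq\mathbb R^n$ and $U\subseteq\mathbb R^m$ are the state space and control set (the same for both problems). For a problem on a horizon $[a,b]$ with dynamics $F:[a,b]\times X\times U\to\mathbb R^n$, running cost $\Lambda:[a,b]\times X\times U\to\mathbb R$ and terminal cost $G:X\to\mathbb R$, put $(L_Fw)(t,x,u):=\partial_tw(t,x)+\nabla_xw(t,x)^\top F(t,x,u)$ for $w\in C^1([a,b]\times X)$. For $\varepsilon,\varepsilon_T\ge0$, $w$ is $(\varepsilon,\varepsilon_T)$-feasible for this problem if $\Lambda+L_Fw\ge-\varepsilon$ on $[a,b]\times X\times U$ and $G-w(b,\cdot)\ge-\varepsilon_T$ on $X$. $\mathcal M_+(\cdot)$ denotes finite nonnegative Borel measures and $\langle\phi,\rho\rangle:=\int\phi\,d\rho$. Given an initial measure $\mu_a$ on $X$ at time $a$, the optimal (occupation-measure LP) value of the problem is the infimum of $\langle\Lambda,\mu\rangle+\langle G,\mu_b\rangle$ over $\mu\in\mathcal M_+([a,b]\times X\times U)$, $\mu_b\in\mathcal M_+(X)$ satisfying $\langle w(b,\cdot),\mu_b\rangle-\langle w(a,\cdot),\mu_a\rangle=\langle L_Fw,\mu\rangle$ for all $w\in C^1([a,b]\times X)$. For the perturbed problem the initial measure at time $\tau$ is $\mu_\tau\in\mathcal M_+(X)$ and the value is $\tilde P$. All pairings are assumed well-defined and finite. $\|\cdot\|_\infty$ is the supremum over the domain (of the Euclidean norm for vector-valued functions), and $\|\nabla_xv\|_\infty$ is assumed finite. *)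

(* Defs.v *)
From HB Require Import structures.
From mathcomp Require Import all_boot all_order all_algebra.
From mathcomp Require Import all_classical all_reals all_analysis.

Set Implicit Arguments.
Unset Strict Implicit.
Unset Printing Implicit Defensive.

Import Order.TTheory GRing.Theory Num.Theory.
Import numFieldNormedType.Exports.

Local Open Scope classical_set_scope.
Local Open Scope ring_scope.

(* The norm of the library on 'rV[R]_n is the maximum norm. *)
Definition euclidean_norm (R : realType) (n : nat) (x : 'rV[R]_n) : R :=
  Num.sqrt (\sum_i x ord0 i ^+ 2).

(* Supremum over D of a nonnegative quantity N, taken in [0, +oo]: it is 0
   rather than -oo when D is empty. *)
Definition sup_norm (R : realType) (T : Type) (D : set T) (N : T -> R)
  : \bar R := maxe 0%E (ereal_sup [set (N z)%:E | z in D]).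

(* w is of class C^1 on A, for an arbitrary A: w is C^1 on some open
   neighbourhood of A.  The derivatives used on A are those of w as a function
   on that neighbourhood. *)
Definition C1_on (R : realType) (V : normedModType R) (A : set V)
    (w : V -> R) : Prop :=
  exists O : set V,
    [/\ open O, A `<=` O,
        forall z, O z -> differentiable w z &
        forall h z, O z -> {for z, continuous (fun y => 'D_h w y)}].

(* The ambient space T with the sigma-algebra generated by the open sets of
   [subspace D].  Its measurable sets contained in D are exactly the Borel sets
   of D for the topology induced by T, and D itself is measurable, whether or
   not D is Borel in T; all subsets of the complement of D are measurable. *)
Notation borel_of D := (g_sigma_algebraType (@open (subspace D))).

(* With the condition below, finite measures on [borel_of D] are the finite
   nonnegative Borel measures on D. *)
Definition carried (R : realType) (T : normedModType R) (D : set T)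
    (mu : {finite_measure set (borel_of D) -> \bar R}) : Prop :=
  mu (~` D) = 0%E.

Definition pairing (R : realType) (T : normedModType R) (D : set T)
    (phi : T -> R) (mu : {finite_measure set (borel_of D) -> \bar R})
  : \bar R := (\int[mu]_(z in (D : set (borel_of D))) (phi z)%:E)%E.

Definition pairing_finite (R : realType) (T : normedModType R) (D : set T)
    (phi : T -> R) (mu : {finite_measure set (borel_of D) -> \bar R}) : Prop :=
  mu.-integrable (D : set (borel_of D)) (fun z => (phi z)%:E).

Section Domains.
Variables (R : realType) (n m : nat).

Definition tx_domain (a b : R) (X : set 'rV[R]_n) : set (R * 'rV[R]_n) :=
  `[a, b] `*` X.

Definition txu_domain (a b : R) (X : set 'rV[R]_n) (U : set 'rV[R]_m)
  : set (R * 'rV[R]_n * 'rV[R]_m) := tx_domain a b X `*` U.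

End Domains.

(* Functions of (t, x, u) and of x are total; only their values on
   [t0, t1] x X x U and on X are ever used. *)
Record problem (R : realType) (n m : nat) := Problem {
  t0 : R;
  t1 : R;
  dynamics : R -> 'rV[R]_n -> 'rV[R]_m -> 'rV[R]_n;
  running_cost : R -> 'rV[R]_n -> 'rV[R]_m -> R;
  terminal_cost : 'rV[R]_n -> R
}.

Section Problem.
Variables (R : realType) (n m : nat).
Implicit Types (P : problem R n m) (w : R * 'rV[R]_n -> R).

Definition d_t w (z : R * 'rV[R]_n) : R := 'D_((1 : R), (0 : 'rV[R]_n)) w z.

Definition grad_x w (z : R * 'rV[R]_n) : 'rV[R]_n :=
  \row_i 'D_((0 : R), (delta_mx ord0 i : 'rV[R]_n)) w z.

Definition L_op P w (t : R) (x : 'rV[R]_n) (u : 'rV[R]_m) : R :=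
  d_t w (t, x) +
  \sum_i grad_x w (t, x) ord0 i * dynamics P t x u ord0 i.

Definition feasible (X : set 'rV[R]_n) (U : set 'rV[R]_m) P
    (eps eps_T : R) w : Prop :=
  [/\ 0 <= eps, 0 <= eps_T, C1_on (tx_domain (t0 P) (t1 P) X) w,
      forall t x u, t0 P <= t <= t1 P -> X x -> U u ->
        - eps <= running_cost P t x u + L_op P w t x u &
      forall x, X x -> - eps_T <= terminal_cost P x - w (t1 P, x)].

(* Constraints of the occupation-measure linear program, including that every
   pairing occurring in its constraints and in its cost is well-defined and
   finite. *)
Definition lp_admissible (X : set 'rV[R]_n) (U : set 'rV[R]_m) P
    (mu_0 : {finite_measure set (borel_of X) -> \bar R})
    (mu :
      {finite_measure set (borel_of (txu_domain (t0 P) (t1 P) X U)) -> \bar R})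
    (mu_1 : {finite_measure set (borel_of X) -> \bar R}) : Prop :=
  [/\ carried mu, carried mu_1,
      pairing_finite (fun z => running_cost P z.1.1 z.1.2 z.2) mu,
      pairing_finite (terminal_cost P) mu_1 &
      forall w, C1_on (tx_domain (t0 P) (t1 P) X) w ->
        [/\ pairing_finite (fun x => w (t1 P, x)) mu_1,
            pairing_finite (fun x => w (t0 P, x)) mu_0,
            pairing_finite (fun z => L_op P w z.1.1 z.1.2 z.2) mu &
            (pairing (fun x => w (t1 P, x)) mu_1 -
             pairing (fun x => w (t0 P, x)) mu_0)%E =
            pairing (fun z => L_op P w z.1.1 z.1.2 z.2) mu]].

Definition lp_value (X : set 'rV[R]_n) (U : set 'rV[R]_m) P
    (mu_0 : {finite_measure set (borel_of X) -> \bar R}) : \bar R :=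
  ereal_inf [set c | exists mu mu_1,
    @lp_admissible X U P mu_0 mu mu_1 /\
    c = (pairing (fun z => running_cost P z.1.1 z.1.2 z.2) mu +
         pairing (terminal_cost P) mu_1)%E].

End Problem.

(* Main.v *)
(* Feasibility is perturbed by |l' - l| and, by Cauchy-Schwarz, by
   |grad v| |f' - f|.  The bound is weak LP duality: test the admissibility
   equation with the feasible function, and compute the masses of the occupation
   and terminal measures by testing it with w = t and w = 1. *)
Require Import Defs.
From mathcomp Require Import all_boot all_order all_algebra.
From mathcomp Require Import all_classical all_reals all_analysis.
From mathcomp Require Import ring lra.

Set Implicit Arguments.
Unset Strict Implicit.
Unset Printing Implicit Defensive.

Import Order.TTheory GRing.Theory Num.Theory.
Import numFieldNormedType.Exports.

Local Open Scope classical_set_scope.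
Local Open Scope ring_scope.

(** * Cauchy-Schwarz for the Euclidean norm *)

Section Euclidean.
Variables (R : realType) (n : nat).
Implicit Types x y : 'rV[R]_n.

Lemma euclidean_norm_ge0 x : 0 <= euclidean_norm x.
Proof. exact: sqrtr_ge0. Qed.

Lemma sqr_euclidean_norm x : euclidean_norm x ^+ 2 = \sum_i x ord0 i ^+ 2.
Proof. by rewrite sqr_sqrtr// sumr_ge0// => i _; exact: sqr_ge0. Qed.

Lemma euclidean_norm_eq0 x : euclidean_norm x = 0 -> forall i, x ord0 i = 0.
Proof.
move=> x0 i; have /eqP := sqr_euclidean_norm x.
rewrite x0 expr0n/= eq_sym psumr_eq0 => [|j _]; last exact: sqr_ge0.
by move=> /allP/(_ i (mem_index_enum i)); rewrite sqrf_eq0 => /eqP.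
Qed.

(** With [a] and [b] the norms of [x] and [y], the sum of the squares of [b x_i + a y_i] expands to
    [2ab] times [ab] plus the dot product, and a positive [ab] can be cancelled. A zero norm forces
    a zero vector, which settles the remaining cases. *)
Lemma euclidean_norm_dot_ge x y :
  - (euclidean_norm x * euclidean_norm y) <= \sum_i x ord0 i * y ord0 i.
Proof.
set a := euclidean_norm x; set b := euclidean_norm y.
have [a0|a_neq0] := eqVneq a 0.
  rewrite a0 mul0r oppr0 sumr_ge0// => i _.
  by rewrite (euclidean_norm_eq0 a0) mul0r.
have [b0|b_neq0] := eqVneq b 0.
  rewrite b0 mulr0 oppr0 sumr_ge0// => i _.
  by rewrite (euclidean_norm_eq0 b0) mulr0.
have ab_gt0 : 0 < a * b.
  by rewrite mulr_gt0// lt_def ?a_neq0 ?b_neq0 euclidean_norm_ge0.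
have : 0 <= \sum_i (b * x ord0 i + a * y ord0 i) ^+ 2.
  by apply: sumr_ge0 => i _; exact: sqr_ge0.
have -> : \sum_i (b * x ord0 i + a * y ord0 i) ^+ 2 =
    (a * b) * (2 * (a * b + \sum_i x ord0 i * y ord0 i)).
  under eq_bigr => i _.
    rewrite (_ : _ ^+ 2 = b ^+ 2 * x ord0 i ^+ 2 + a ^+ 2 * y ord0 i ^+ 2
      + 2 * a * b * (x ord0 i * y ord0 i)); last by ring.
    over.
  rewrite !big_split/= -!mulr_sumr -!sqr_euclidean_norm -/a -/b; ring.
by rewrite !pmulr_rge0//; lra.
Qed.

End Euclidean.

(** * Pointwise bounds extracted from suprema *)

Section SupNorm.
Variables (R : realType) (T : Type) (D : set T) (N : T -> R).

Lemma sup_norm_ge0 : (0 <= sup_norm D N)%E.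
Proof. by rewrite /sup_norm le_max lexx. Qed.

Lemma le_sup_norm z : D z -> ((N z)%:E <= sup_norm D N)%E.
Proof.
by move=> Dz; rewrite le_max ereal_sup_ubound ?orbT//; exists z.
Qed.

End SupNorm.

(** * Invariance of derivatives and of C^1 regularity under translation *)

Section Translation.
Variables (R : realType) (V : normedModType R) (s : V).
Implicit Types w : V -> R.

Lemma derive_translate w h z :
  'D_h (fun y => w (y - s)) z = 'D_h w (z - s).
Proof.
rewrite /derive /=; under eq_fun do rewrite -addrA.
by [].
Qed.

Lemma translate_continuous : continuous (fun y : V => y - s).
Proof.
by move=> y; apply: cvgB; [exact: cvg_id|exact: cvg_cst].
Qed.

Lemma C1_on_translate (A B : set V) w :
  (forall z, B z -> A (z - s)) -> C1_on A w -> C1_on B (fun y => w (y - s)).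
Proof.
(* The neighbourhood of [B] is the preimage under the shift of the one given for [A]. *)
move=> BA [W [oW AW dw cw]]; exists [set z | W (z - s)]; split.
- by apply: open_comp oW => y _; exact: translate_continuous.
- by move=> z /BA/AW.
- move=> z Wz; apply: (@differentiable_comp _ _ _ _ (fun y => y - s) w).
  + exact: ex_diff.
  + exact: dw.
- move=> h z Wz; rewrite (funext (derive_translate w h)).
  apply: (@continuous_comp _ _ _ (fun y => y - s) (fun y => 'D_h w y)).
    exact: translate_continuous.
  exact: cw.
Qed.

End Translation.

(** [D] is open in its own subspace topology, so it is one of the generators of the sigma-algebra,
    whether or not it is Borel in [T]. *)
Lemma measurable_domain (R : realType) (T : normedModType R) (D : set T) :
  measurable (D : set (borel_of D)).
Proof. by apply: sub_gen_smallest; exact: open_subspaceT. Qed.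

Lemma fin_num_domain (R : realType) (T : normedModType R) (D : set T)
    (mu : {finite_measure set (borel_of D) -> \bar R}) : mu D \is a fin_num.
Proof. by apply: fin_num_measure; exact: measurable_domain. Qed.

(** * The test functions 1 and t *)

Section TestFunctions.
Variables (R : realType) (n m : nat) (P : problem R n m).

Lemma C1_on_cst (V : normedModType R) (A : set V) (c : R) : C1_on A (cst c).
Proof.
exists setT; split => //; first exact: openT.
- by move=> h z _; rewrite (funext (derive_cst c ^~ h)); exact: cvg_cst.
Qed.

Lemma derive_fst (h z : R * 'rV[R]_n) : 'D_h (@fst R 'rV[R]_n) z = h.1.
Proof.
have cfst : continuous (@fst R 'rV[R]_n) by move=> y; exact: cvg_fst.
(* The projection is linear and continuous, hence its own differential. *)
rewrite deriveE; last exact: linear_differentiable.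
by rewrite diff_lin.
Qed.

Lemma C1_on_fst (A : set (R * 'rV[R]_n)) : C1_on A fst.
Proof.
exists setT; split => //; first exact: openT.
- move=> z _; apply: linear_differentiable => y; exact: cvg_fst.
- by move=> h z _; rewrite (funext (derive_fst h)); exact: cvg_cst.
Qed.

Lemma L_op_cst c t x u : L_op P (cst c) t x u = 0.
Proof.
rewrite /L_op /d_t derive_cst add0r big1// => i _.
by rewrite mxE derive_cst mul0r.
Qed.

Lemma L_op_fst t x u : L_op P fst t x u = 1.
Proof.
rewrite /L_op /d_t derive_fst big1 ?addr0// => i _.
by rewrite mxE derive_fst mul0r.
Qed.

End TestFunctions.

(** * Linearity and monotonicity of pairings *)

Lemma pairing_cst (R : realType) (T : normedModType R) (D : set T)
    (mu : {finite_measure set (borel_of D) -> \bar R}) (c : R) :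
  pairing (cst c) mu = (c%:E * mu D)%E.
Proof. by rewrite /pairing -integral_cst//; exact: measurable_domain. Qed.

Lemma le_pairing (R : realType) (T : normedModType R) (D : set T)
    (mu : {finite_measure set (borel_of D) -> \bar R}) (phi psi : T -> R) :
  pairing_finite phi mu -> pairing_finite psi mu ->
  (forall z, D z -> phi z <= psi z) -> (pairing phi mu <= pairing psi mu)%E.
Proof.
move=> phi_fin psi_fin le_phi_psi; apply: le_integral => //.
  exact: measurable_domain.
by move=> z; rewrite inE => Dz; rewrite lee_fin le_phi_psi.
Qed.

Lemma pairing_finite_cst (R : realType) (T : normedModType R) (D : set T)
    (mu : {finite_measure set (borel_of D) -> \bar R}) (c : R) :
  pairing_finite (cst c) mu.
Proof. by apply: finite_measure_integrable_cst; exact: measurable_domain. Qed.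

Lemma pairing_finiteD (R : realType) (T : normedModType R) (D : set T)
    (mu : {finite_measure set (borel_of D) -> \bar R}) (phi psi : T -> R) :
  pairing_finite phi mu -> pairing_finite psi mu ->
  pairing_finite (fun z => phi z + psi z) mu.
Proof.
move=> phi_fin psi_fin; apply: (integrableD _ phi_fin psi_fin).
exact: measurable_domain.
Qed.

Lemma pairingD (R : realType) (T : normedModType R) (D : set T)
    (mu : {finite_measure set (borel_of D) -> \bar R}) (phi psi : T -> R) :
  pairing_finite phi mu -> pairing_finite psi mu ->
  pairing (fun z => phi z + psi z) mu = (pairing phi mu + pairing psi mu)%E.
Proof.
move=> phi_fin psi_fin; apply: (integralD _ phi_fin psi_fin).
exact: measurable_domain.
Qed.

Lemma pairing_fin_num (R : realType) (T : normedModType R) (D : set T)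
    (mu : {finite_measure set (borel_of D) -> \bar R}) (phi : T -> R) :
  pairing_finite phi mu -> pairing phi mu \is a fin_num.
Proof. by apply: integrable_fin_num; exact: measurable_domain. Qed.

(** * Masses of admissible measures and weak duality *)

Section WeakDuality.
Variables (R : realType) (n m : nat) (X : set 'rV[R]_n) (U : set 'rV[R]_m).
Variable P : problem R n m.
Variables (mu_0 mu_1 : {finite_measure set (borel_of X) -> \bar R}).
Variable mu :
  {finite_measure set (borel_of (txu_domain (t0 P) (t1 P) X U)) -> \bar R}.
Hypothesis adm : lp_admissible mu_0 mu mu_1.

(** [L_op] kills constants, so mass is conserved between the two end times. *)
Lemma lp_admissible_terminal_mass : mu_1 X = mu_0 X.
Proof.
case: adm => _ _ _ _ /(_ _ (C1_on_cst _ 1)) [_ _ _].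
have -> : (fun z => L_op P (cst 1) z.1.1 z.1.2 z.2) = cst 0.
  by apply/funext => z; exact: L_op_cst.
rewrite !pairing_cst !mul1e mul0e.
(* Both masses are finite, so the vanishing difference can be read in [R]. *)
move: (fin_num_domain mu_1) (fin_num_domain mu_0) => /fineK <- /fineK <-.
by rewrite -EFinB => -[/subr0_eq ->].
Qed.

(** Time has unit derivative along any dynamics, so testing with it turns the right-hand side into
    the total mass of [mu]. The left-hand side is a difference of [t1 P] and [t0 P] weighted by the
    terminal and initial masses, which agree. *)
Lemma lp_admissible_mass :
  mu (txu_domain (t0 P) (t1 P) X U) = ((t1 P - t0 P)%:E * mu_0 X)%E.
Proof.
case: adm => _ _ _ _ /(_ _ (C1_on_fst _)) [_ _ _] /=.
have -> : (fun z => L_op P fst z.1.1 z.1.2 z.2) = cst 1.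
  by apply/funext => z; exact: L_op_fst.
rewrite -!/(cst _) !pairing_cst mul1e lp_admissible_terminal_mass => <-.
by rewrite EFinB muleBl// fin_num_domain.
Qed.

(** The running inequality is integrated against [mu], the terminal one against [mu_1]. In their sum
    the admissibility equation cancels the terminal pairing of [w] and leaves the initial one; each
    slack is multiplied by the mass of its measure. *)
Lemma lp_weak_duality eps eps_T w : feasible X U P eps eps_T w ->
  (pairing (fun x => w (t0 P, x)) mu_0
     - (t1 P - t0 P)%:E * mu_0 X * eps%:E - mu_0 X * eps_T%:E
   <= pairing (fun z => running_cost P z.1.1 z.1.2 z.2) mu +
      pairing (terminal_cost P) mu_1)%E.
Proof.
case=> _ _ w_C1 running_ge terminal_ge.
case: (adm) => _ _ l_fin g_fin /(_ _ w_C1) [w1_fin w0_fin Lw_fin eq_Lw].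
have : (- eps%:E * mu (txu_domain (t0 P) (t1 P) X U) <=
    pairing (fun z => running_cost P z.1.1 z.1.2 z.2) mu +
    pairing (fun z => L_op P w z.1.1 z.1.2 z.2) mu)%E.
  rewrite -pairingD// -EFinN -pairing_cst; apply: le_pairing.
  - exact: pairing_finite_cst.
  - exact: pairing_finiteD.
  - by move=> [[t x] u] [[/= t_in Xx] Uu]; exact: running_ge.
have : (pairing (fun x => w (t1 P, x)) mu_1 - eps_T%:E * mu_1 X <=
    pairing (terminal_cost P) mu_1)%E.
  rewrite -mulNe -EFinN -pairing_cst -pairingD//; last exact: pairing_finite_cst.
  apply: le_pairing => //.
    by apply: pairing_finiteD => //; exact: pairing_finite_cst.
  by move=> x Xx; have := terminal_ge _ Xx; rewrite /cst; lra.
rewrite -eq_Lw lp_admissible_mass lp_admissible_terminal_mass.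
(* Every mass and pairing involved is finite, so the claim becomes linear arithmetic in [R]. *)
move: (fin_num_domain mu_0) (pairing_fin_num w1_fin) (pairing_fin_num w0_fin)
  (pairing_fin_num l_fin) (pairing_fin_num g_fin).
move=> /fineK <- /fineK <- /fineK <- /fineK <- /fineK <-.
rewrite -!EFinN -!EFinM -!EFinD !lee_fin; lra.
Qed.

End WeakDuality.

(** A time shift is the translation by [(s, 0)], which commutes with all directional derivatives.
    Hence the two operators differ only through their dynamics, and this difference is exactly the
    term that Cauchy-Schwarz will bound. *)
Lemma L_op_translate (R : realType) (n m : nat) (P Q : problem R n m)
    (w : R * 'rV[R]_n -> R) (s : R) t x u :
  L_op P (fun z => w (z.1 - s, z.2)) t x u =
  L_op Q w (t - s) x u
    + \sum_i grad_x w (t - s, x) ord0 i *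
        (dynamics P t x u - dynamics Q (t - s) x u) ord0 i.
Proof.
have -> : (fun z : R * 'rV[R]_n => w (z.1 - s, z.2)) = (fun z => w (z - (s, 0))).
  by apply/funext => -[r y]; congr w; congr pair; rewrite /= subr0.
have zE : (t - s, x) = (t, x) - (s, 0) :> R * 'rV[R]_n.
  by congr pair; rewrite /= subr0.
rewrite /L_op -addrA; congr (_ + _).
  by rewrite /d_t derive_translate zE.
rewrite -big_split/=; apply: eq_bigr => i _.
rewrite -mulrDr !mxE subrKC derive_translate zE//.
Qed.

Theorem proposition6 (R : realType) (n m : nat)
    (X : set 'rV[R]_n) (U : set 'rV[R]_m)
    (H : R) (H_gt0 : 0 < H)
    (f : R -> 'rV[R]_n -> 'rV[R]_m -> 'rV[R]_n)
    (l : R -> 'rV[R]_n -> 'rV[R]_m -> R)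
    (g : 'rV[R]_n -> R)
    (v : R * 'rV[R]_n -> R) (eps eps_T : R)
    (v_feasible : feasible X U (Problem 0 H f l g) eps eps_T v)
    (grad_finite :
      sup_norm (tx_domain 0 H X) (fun z => euclidean_norm (grad_x v z))
        \is a fin_num)
    (tau : R)
    (f' : R -> 'rV[R]_n -> 'rV[R]_m -> 'rV[R]_n)
    (l' : R -> 'rV[R]_n -> 'rV[R]_m -> R)
    (g' : 'rV[R]_n -> R)
    (delta_f delta_l delta_g : R)
    (f'_close :
      let f_tau := fun t x u => f (t - tau) x u in
      (sup_norm (txu_domain tau (tau + H)%R X U)
        (fun z => euclidean_norm
          (f' z.1.1 z.1.2 z.2 - f_tau z.1.1 z.1.2 z.2)%R)
        <= delta_f%:E)%E)
    (l'_close :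
      let l_tau := fun t x u => l (t - tau) x u in
      (sup_norm (txu_domain tau (tau + H)%R X U)
        (fun z => `|l' z.1.1 z.1.2 z.2 - l_tau z.1.1 z.1.2 z.2|%R)
        <= delta_l%:E)%E)
    (g'_close : (sup_norm X (fun x => `|g' x - g x|%R) <= delta_g%:E)%E)
    (mu_tau : {finite_measure set (borel_of X) -> \bar R})
    (mu_tau_X : carried mu_tau) :
  let v_tau := fun z : R * 'rV[R]_n => v (z.1 - tau, z.2) in
  let eps' := eps + delta_l +
    fine (sup_norm (tx_domain 0 H X) (fun z => euclidean_norm (grad_x v z)))
      * delta_f in
  let eps_T' := eps_T + delta_g in
  let P' := Problem tau (tau + H) f' l' g' in
  feasible X U P' eps' eps_T' v_tau /\
  (pairing_finite (fun x => v_tau (tau, x)) mu_tau ->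
   (pairing (fun x => v_tau (tau, x)) mu_tau
      - H%:E * mu_tau X * eps'%:E - mu_tau X * eps_T'%:E
    <= lp_value U P' mu_tau)%E).
Proof.
(* The tolerances are nonnegative even on empty domains, since [sup_norm] is at least 0 by
   definition. *)
have dg_ge0 : 0 <= delta_g.
  by rewrite -lee_fin; apply: le_trans g'_close; exact: sup_norm_ge0.
have dl_ge0 : 0 <= delta_l.
  by rewrite -lee_fin; apply: le_trans l'_close; exact: sup_norm_ge0.
have df_ge0 : 0 <= delta_f.
  by rewrite -lee_fin; apply: le_trans f'_close; exact: sup_norm_ge0.
move=> v_tau eps' eps_T' P'; rewrite /eps'.
set G := fine _.
have G_ge0 : 0 <= G by rewrite fine_ge0// sup_norm_ge0.
have v_tau_feasible : feasible X U P' eps' eps_T' v_tau.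
  case: v_feasible => /= eps_ge0 epsT_ge0 v_C1 run_ge term_ge; split => /=.
  - by rewrite !addr_ge0// mulr_ge0.
  - exact: addr_ge0.
  - have -> : v_tau = (fun z => v (z - (tau, 0))).
      by apply/funext => -[r y]; congr v; congr pair; rewrite /= subr0.
    apply: C1_on_translate v_C1 => -[t x] [/= + Xx].
    by rewrite !in_itv/= => t_in; split; rewrite /= ?subr0// in_itv/=; lra.
  - move=> t x u t_in Xx Uu; rewrite (L_op_translate P' (Problem 0 H f l g)).
    have s_in : 0 <= t - tau <= H by lra.
    have dom : txu_domain tau (tau + H) X U (t, x, u).
      by do 2 split => //=; rewrite in_itv.
    (* The nominal inequality at time [t - tau] loses at most [delta_l] from the cost, where only
       the lower side of the absolute value matters, and at most the product of the two norms from
       the dynamics. *)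
    have := run_ge _ _ _ s_in Xx Uu.
    have := euclidean_norm_dot_ge (grad_x v (t - tau, x))
      (f' t x u - f (t - tau) x u).
    have := le_trans (le_sup_norm _ dom) l'_close.
    have := le_trans (le_sup_norm _ dom) f'_close.
    rewrite /= !lee_fin ler_norml => f_close /andP[l_close _] cs run.
    (* Finiteness of the supremum of the gradient makes its real part [G] a genuine upper bound. *)
    have grad_le : euclidean_norm (grad_x v (t - tau, x)) <= G.
      rewrite -lee_fin fineK//.
      apply: (le_sup_norm (fun z => euclidean_norm (grad_x v z))).
      by split => //=; rewrite in_itv.
    (* Once the product of norms is bounded by [G * delta_f], what remains is linear. *)
    have := ler_pM (euclidean_norm_ge0 _) (euclidean_norm_ge0 _)
      grad_le f_close.
    rewrite /eps' -/G; lra.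
  - move=> x Xx; have := term_ge _ Xx.
    have := le_trans (le_sup_norm _ Xx) g'_close.
    rewrite lee_fin ler_norml /v_tau /= => /andP[g_close _].
    by rewrite (_ : tau + H - tau = H) /eps_T'; lra.
(* It suffices to bound the cost of each admissible pair; with no such pair the infimum is [+oo]. *)
split=> // _; apply: le_ereal_inf_tmp => _ [mu [mu_1 [adm ->]]].
have := lp_weak_duality adm v_tau_feasible.
by rewrite /= (_ : tau + H - tau = H) //; lra.
Qed.
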